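(* Let $d,m,k\ge 1$ be integers, $L,\beta>0$, $T=km$ and $0<\eta\le\frac{2}{\beta}$. Let $Z$ be a set of examples and $\ell:\mathbb{R}^d\times Z\to\mathbb{R}$ a loss function such that for every $z\in Z$ the function $\ell(\cdot,z)$ is convex, $L$-Lipschitz and $\beta$-smooth on $\mathbb{R}^d$. Consider $k$-pass PSGD with constant step size $\eta_1=\cdots=\eta_T=\eta$ and a fixed starting point. For neighboring $S\sim S'$ in $Z^m$ and a permutation $r$ of $[m]$, let $\delta_T=\|w_T-w_T'\|$ where $w_T$ and $w_T'$ are the final iterates on $S$ and $S'$, respectively, using the same permutation $r$ and the same starting point. Then $$\sup_{S\sim S'}\sup_r\delta_T\le 2kL\eta .$$
   Context: $\|\cdot\|$ is the Euclidean norm and $[m]=\{1,\dots,m\}$. A differentiable $f:\mathbb{R}^d\to\mathbb{R}$ is convex if $f(u)\ge f(v)+\langle\nabla f(v),u-v\rangle$ for all $u,v$; $L$-Lipschitz if $|f(u)-f(v)|\le L\|u-v\|$; $\beta$-smooth if $\|\nabla f(u)-\nabla f(v)\|\le\beta\|u-v\|$. $k$-pass PSGD (permutation-based SGD) on $S=(z_1,\dots,z_m)\in Z^m$ with permutation $r$ of $[m]$, step sizes $\eta_1,\dots,\eta_{km}$ and starting point $w_0$: for $t=1,\dots,km$ write $t=s+jm$ with $1\le s\le m$, $0\le j\le k-1$, and set $w_t=w_{t-1}-\eta_t\nabla\ell(w_{t-1},z_{r^{-1}(s)})$ (gradient in the first argument). Two datasets $S,S'\in Z^m$ are neighboring, $S\sim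 S'$, if they differ in a single entry. *)

(* Defs.v *)
From HB Require Import structures.
From mathcomp Require Import all_boot all_order all_algebra all_fingroup.
From mathcomp Require Import all_classical all_reals all_analysis.

Set Implicit Arguments.
Unset Strict Implicit.
Unset Printing Implicit Defensive.

Import Order.TTheory GRing.Theory Num.Theory.
Import numFieldNormedType.Exports.

Local Open Scope classical_set_scope.
Local Open Scope ring_scope.

(* The norm that the library puts on 'rV[R]_d is the sup norm, so the
   Euclidean structure is introduced here.  Both norms induce the same
   topology, hence the same notion of differentiability. *)
Definition dotp (R : realType) (d : nat) (u v : 'rV[R]_d) : R :=
  \sum_(i < d) u 0 i * v 0 i.

Definition enorm (R : realType) (d : nat) (u : 'rV[R]_d) : R :=
  Num.sqrt (dotp u u).

(* Only meaningful where f is differentiable. *)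
Definition grad (R : realType) (d : nat) (f : 'rV[R]_d -> R) (w : 'rV[R]_d) :
    'rV[R]_d :=
  \row_(i < d) 'D_(delta_mx 0 i) f w.

(* First-order definition, for differentiable f. *)
Definition is_convex (R : realType) (d : nat) (f : 'rV[R]_d -> R) : Prop :=
  forall u v, f v + dotp (grad f v) (u - v) <= f u.

Definition is_lipschitz (R : realType) (d : nat) (L : R) (f : 'rV[R]_d -> R) :
    Prop :=
  forall u v, `|f u - f v| <= L * enorm (u - v).

Definition is_smooth (R : realType) (d : nat) (beta : R) (f : 'rV[R]_d -> R) :
    Prop :=
  forall u v, enorm (grad f u - grad f v) <= beta * enorm (u - v).

(* psgd hm l eta S r w0 t is the iterate w_t.  Steps t = 1, 2, ... and step
   sizes eta t are numbered from 1, whereas dataset positions are 'I_m, from 0: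
   if t.+1 = s + j * m with 1 <= s <= m, then t %% m = s - 1. *)
Fixpoint psgd (R : realType) (d m : nat) (hm : (0 < m)%N) (Z : Type)
    (l : 'rV[R]_d -> Z -> R) (eta : nat -> R) (S : m.-tuple Z)
    (r : {perm 'I_m}) (w0 : 'rV[R]_d) (t : nat) : 'rV[R]_d :=
  if t is t'.+1 then
    let w := psgd hm l eta S r w0 t' in
    let s := Ordinal (ltn_pmod t' hm) in
    w - eta t *: grad (l ^~ (tnth S ((r^-1)%g s))) w
  else w0.

Definition neighboring (m : nat) (Z : Type) (S S' : m.-tuple Z) : Prop :=
  exists i : 'I_m, tnth S i <> tnth S' i /\
    forall j : 'I_m, j != i -> tnth S j = tnth S' j.

(* The distance between the final iterates of k-pass PSGD on S and on S'. *)
Definition psgd_delta (R : realType) (d m : nat) (hm : (0 < m)%N) (k : nat)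
    (Z : Type) (l : 'rV[R]_d -> Z -> R) (eta : nat -> R) (w0 : 'rV[R]_d)
    (S S' : m.-tuple Z) (r : {perm 'I_m}) : R :=
  enorm (psgd hm l eta S r w0 (k * m) - psgd hm l eta S' r w0 (k * m)).

(* Main.v *)
(* Convexity and smoothness make the gradient cocoercive, so the gradient map
   w |-> w - eta *: grad f w with eta <= 2 / beta does not increase Euclidean
   distances.  The distance between the two trajectories can thus only grow at
   the k steps that use the entry where the datasets differ, each time by at
   most 2 * L * eta because gradients have norm at most L. *)

Require Import Defs.
From HB Require Import structures.
From mathcomp Require Import all_boot all_order all_algebra all_fingroup.
From mathcomp Require Import all_classical all_reals all_analysis.
From mathcomp Require Import zify ring lra.

Set Implicit Arguments.
Unset Strict Implicit.
Unset Printing Implicit Defensive.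

Import Order.TTheory GRing.Theory Num.Theory.
Import numFieldNormedType.Exports.

Local Open Scope classical_set_scope.
Local Open Scope ring_scope.

(** * Euclidean inner product and norm *)

Section EuclideanSpace.
Context {R : realType} {d : nat}.
Implicit Types (u v w : 'rV[R]_d) (c : R).

Lemma dotpC u v : dotp u v = dotp v u.
Proof. by apply: eq_bigr => i _; rewrite mulrC. Qed.

Lemma dotpDl u v w : dotp (u + v) w = dotp u w + dotp v w.
Proof. by rewrite -big_split; apply: eq_bigr => i _; rewrite mxE mulrDl. Qed.

Lemma dotpZl c u v : dotp (c *: u) v = c * dotp u v.
Proof. by rewrite /dotp mulr_sumr; apply: eq_bigr => i _; rewrite mxE mulrA. Qed.

Lemma dotpNl u v : dotp (- u) v = - dotp u v.
Proof. by rewrite -scaleN1r dotpZl mulN1r. Qed.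

Lemma dotpBl u v w : dotp (u - v) w = dotp u w - dotp v w.
Proof. by rewrite dotpDl dotpNl. Qed.

Lemma dotpDr u v w : dotp w (u + v) = dotp w u + dotp w v.
Proof. by rewrite dotpC dotpDl !(dotpC w). Qed.

Lemma dotpZr c u v : dotp u (c *: v) = c * dotp u v.
Proof. by rewrite dotpC dotpZl dotpC. Qed.

Lemma dotpNr u v : dotp u (- v) = - dotp u v.
Proof. by rewrite dotpC dotpNl dotpC. Qed.

Lemma dotpBr u v w : dotp w (u - v) = dotp w u - dotp w v.
Proof. by rewrite dotpDr dotpNr. Qed.

Lemma dotp_ge0 u : 0 <= dotp u u.
Proof. by apply: sumr_ge0 => i _; rewrite -expr2 sqr_ge0. Qed.

Lemma dotp_eq0 u : dotp u u = 0 -> u = 0.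
Proof.
move=> /eqP; rewrite psumr_eq0; last by move=> i _; rewrite -expr2 sqr_ge0.
move=> /allP u0; apply/rowP => i; rewrite mxE.
by have /(_ (mem_index_enum i)) := u0 i; rewrite mulf_eq0 orbb => /eqP.
Qed.

Lemma enorm_ge0 u : 0 <= enorm u.
Proof. exact: sqrtr_ge0. Qed.

Lemma sqr_enorm u : enorm u ^+ 2 = dotp u u.
Proof. by rewrite sqr_sqrtr // dotp_ge0. Qed.

Lemma enorm0 : enorm (0 : 'rV[R]_d) = 0.
Proof. by rewrite /enorm -(scale0r 0) dotpZl mul0r sqrtr0. Qed.

Lemma enormZ c u : enorm (c *: u) = `|c| * enorm u.
Proof. by rewrite /enorm dotpZl dotpZr mulrA -expr2 sqrtrM ?sqr_ge0 // sqrtr_sqr. Qed.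

Lemma enormN u : enorm (- u) = enorm u.
Proof. by rewrite -scaleN1r enormZ normrN1 mul1r. Qed.

(** Cauchy-Schwarz: the squared norm of [dotp v v *: u - dotp u v *: v] is nonnegative and factors
    as [dotp v v] times the gap between the squares of the two sides. *)
Lemma dotp_le_enorm u v : dotp u v <= enorm u * enorm v.
Proof.
rewrite -sqrtrM ?dotp_ge0 //.
apply: le_trans (ler_norm _) _; rewrite -sqrtr_sqr ler_sqrt; last first.
  by rewrite mulr_ge0 ?dotp_ge0.
have [v0|v_neq0] := eqVneq (dotp v v) 0.
  by rewrite (dotp_eq0 v0) -(scale0r 0) !dotpZr !mul0r expr0n mulr0.
have v_gt0 : 0 < dotp v v by rewrite lt_neqAle eq_sym v_neq0 dotp_ge0.
have := dotp_ge0 (dotp v v *: u - dotp u v *: v).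
rewrite !(dotpBl, dotpBr, dotpZl, dotpZr) (dotpC v u).
set a := dotp u u; set b := dotp u v; set c := dotp v v => h.
rewrite -subr_ge0 -(pmulr_rge0 _ v_gt0) -/c.
by apply: le_trans h _; rewrite le_eqVlt; apply/orP; left; apply/eqP; ring.
Qed.

Lemma enormD u v : enorm (u + v) <= enorm u + enorm v.
Proof.
rewrite -(@ler_pXn2r _ 2) ?nnegrE ?addr_ge0 ?enorm_ge0 //.
have := dotp_le_enorm u v.
rewrite sqrrD !sqr_enorm !dotpDl !dotpDr (dotpC v u) => ?; lra.
Qed.

End EuclideanSpace.

(** * Gradient inequalities and the effect of one gradient step *)

Section GradientStep.
Context {R : realType} {d : nat}.
Implicit Types (f : 'rV[R]_d -> R) (u v w x y h : 'rV[R]_d).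

(** Moving from [w] by the gradient [g] itself, convexity makes [f] grow by at least [enorm g ^+ 2],
    while the Lipschitz bound allows at most [L * enorm g]. *)
Lemma enorm_grad_le f (L : R) w : 0 <= L ->
  is_convex f -> is_lipschitz L f -> enorm (grad f w) <= L.
Proof.
move=> L_ge0 cf lf; set g := grad f w.
have := cf (w + g) w; have := lf (w + g) w.
rewrite [w + g]addrC addrK -/g -sqr_enorm => /(le_trans (ler_norm _)) h1 h2.
have : enorm g * enorm g <= L * enorm g by rewrite -expr2; lra.
have [-> //|g_neq0] := eqVneq (enorm g) 0.
by rewrite ler_pM2r // lt_neqAle eq_sym g_neq0 enorm_ge0.
Qed.

(* Convexity at the points x + i *: e replaces the integral of the gradient
   along the segment by Riemann sums. *)
Lemma descent_sum f (beta : R) x e (n : nat) :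
  is_convex f -> is_smooth beta f ->
  f (x + n%:R *: e) <=
    f x + n%:R * dotp (grad f x) e
        + beta * dotp e e * (n%:R * (n%:R + 1) / 2).
Proof.
move=> cf sf; elim: n => [|n IHn]; first by rewrite scale0r addr0 !mul0r mulr0 !addr0.
set y := x + n.+1%:R *: e.
have yE : x + n%:R *: e = y - e.
  by rewrite /y -natr1 scalerDl scale1r addrA addrK.
(* Convexity at the new endpoint [y] bounds the last increment of [f] by [dotp (grad f y) e].
   Replacing [grad f y] by [grad f x] costs [beta * n.+1%:R * dotp e e], and these costs add up to
   the triangular number in the statement. *)
have := cf (y - e) y; rewrite [y - e]addrC addrK dotpNr [- e + y]addrC -yE => h1.
have h2 : dotp (grad f y - grad f x) e <= beta * (n.+1%:R * dotp e e).
  apply: le_trans (dotp_le_enorm _ _) _.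
  have := ler_wpM2r (enorm_ge0 e) (sf y x).
  rewrite [y]addrC addrK enormZ ger0_norm // -!mulrA -expr2 sqr_enorm.
  by rewrite [_ + x]addrC.
move: h2 IHn; rewrite dotpBl -natr1 => h2 IHn; lra.
Qed.

Lemma descent_lemma f (beta : R) x h :
  is_convex f -> is_smooth beta f ->
  f (x + h) <= f x + dotp (grad f x) h + beta / 2 * dotp h h.
Proof.
move=> cf sf; apply/ler_addgt0Pr => eps eps_gt0.
set B := beta / 2 * dotp h h.
(* With [n.+1] equal pieces of [h], the sum exceeds the target bound by exactly [B / n.+1%:R], so
   [n] is chosen to make this at most [eps]. *)
have [n hn] : exists n : nat, `|B| / eps < n.+1%:R.
  exists (Num.bound (`|B| / eps)).
  apply: lt_trans (archi_boundP _) _; first by rewrite divr_ge0 // ltW.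
  by rewrite ltr_nat.
have N_neq0 : n.+1%:R != 0 :> R by rewrite pnatr_eq0.
have := descent_sum x (n.+1%:R^-1 *: h) n.+1 cf sf.
rewrite scalerA divff // scale1r !dotpZr dotpZl.
have -> : n.+1%:R * (n.+1%:R^-1 * dotp (grad f x) h) = dotp (grad f x) h by field.
have -> : beta * (n.+1%:R^-1 * (n.+1%:R^-1 * dotp h h)) *
    (n.+1%:R * (n.+1%:R + 1) / 2) = B + B / n.+1%:R by rewrite /B; field.
have : B / n.+1%:R <= eps.
  rewrite ler_pdivrMr ?ltr0Sn // mulrC -ler_pdivrMr //.
  apply: le_trans (ltW hn); rewrite ler_pM2r ?invr_gt0 //; exact: ler_norm.
by move=> B_le /le_trans; apply; rewrite addrA lerD2l.
Qed.

(** The point [y - beta^-1 *: q] minimizes the quadratic upper bound at [y] for [f] minus its linear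
    part at [x]. There the descent lemma from [y] bounds [f] above and convexity from [x] bounds it
    below. *)
Lemma grad_gap f (beta : R) x y : 0 < beta ->
  is_convex f -> is_smooth beta f ->
  dotp (grad f y - grad f x) (grad f y - grad f x) / (2 * beta) <=
    f y - f x - dotp (grad f x) (y - x).
Proof.
move=> b_gt0 cf sf; set q := grad f y - grad f x.
have b_neq0 : beta != 0 by rewrite gt_eqF.
have gyq : dotp (grad f y) q = dotp (grad f x) q + dotp q q.
  by rewrite -dotpDl addrC /q subrK.
have := cf (y + - beta^-1 *: q) x; have := descent_lemma y (- beta^-1 *: q) cf sf.
clearbody q.
rewrite addrAC !(dotpDr, dotpZr, dotpZl, dotpNr).
rewrite gyq.
have -> : beta / 2 * (- beta^-1 * (- beta^-1 * dotp q q)) =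
  dotp q q / (2 * beta) by field.
have -> : - beta^-1 * (dotp (grad f x) q + dotp q q) =
  - beta^-1 * dotp (grad f x) q - 2 * (dotp q q / (2 * beta)) by field.
by move=> ? ?; lra.
Qed.

(** Adding [grad_gap] for [(x, y)] and [(y, x)] cancels the function values, and the two halves
    [q / (2 * beta)] combine. *)
Lemma cocoercive f (beta : R) x y : 0 < beta ->
  is_convex f -> is_smooth beta f ->
  dotp (grad f x - grad f y) (grad f x - grad f y) <=
    beta * dotp (grad f x - grad f y) (x - y).
Proof.
move=> b_gt0 cf sf.
have := grad_gap x y b_gt0 cf sf; have := grad_gap y x b_gt0 cf sf.
rewrite -(opprB x y) -(opprB (grad f x) (grad f y)) !(dotpNl, dotpNr) !opprK.
rewrite (dotpBl _ _ (x - y)).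
set q := dotp _ _ => h1 h2.
have -> : q = beta * (q / (2 * beta) + q / (2 * beta)).
  by field; rewrite gt_eqF.
rewrite ler_pM2l //; move: h1 h2; lra.
Qed.

(** With [e = u - v] and [g] the gradient difference, the squared distance changes by
    [eta * (eta * dotp g g - 2 * dotp g e)]. Cocoercivity and [eta <= 2 / beta] make this
    nonpositive. *)
Lemma gradient_step_nonexpansive f (beta eta : R) u v : 0 < beta ->
  0 <= eta <= 2 / beta -> is_convex f -> is_smooth beta f ->
  enorm ((u - eta *: grad f u) - (v - eta *: grad f v)) <= enorm (u - v).
Proof.
move=> b_gt0 /andP[eta_ge0 eta_le] cf sf.
rewrite -(@ler_pXn2r _ 2) ?nnegrE ?enorm_ge0 // !sqr_enorm.
have -> : (u - eta *: grad f u) - (v - eta *: grad f v) =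
    (u - v) - eta *: (grad f u - grad f v).
  by rewrite scalerBr !opprB [_ - v]addrC addrACA [- _ + _]addrC.
have := cocoercive u v b_gt0 cf sf.
set g := grad f u - grad f v; set e := u - v => gg_le; clearbody g e.
rewrite !(dotpBl, dotpBr, dotpZl, dotpZr) (dotpC e g).
have ge_ge0 : 0 <= dotp g e.
  by rewrite -(pmulr_rge0 _ b_gt0) (le_trans (dotp_ge0 g)).
have h1 : eta * dotp g g <= 2 * dotp g e.
  apply: le_trans (_ : 2 / beta * (beta * dotp g e) <= _).
    by apply: ler_pM => //; rewrite dotp_ge0.
  by rewrite mulrA divfK ?gt_eqF.
have := ler_wpM2l eta_ge0 h1; lra.
Qed.

(** Used where the two runs see different losses: each gradient has norm at most [L], so the
    triangle inequality suffices. *)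
Lemma gradient_step_lipschitz f f' (L eta : R) u v : 0 <= L -> 0 <= eta ->
  is_convex f -> is_lipschitz L f -> is_convex f' -> is_lipschitz L f' ->
  enorm ((u - eta *: grad f u) - (v - eta *: grad f' v)) <=
    enorm (u - v) + 2 * L * eta.
Proof.
move=> L_ge0 eta_ge0 cf lf cf' lf'.
have -> : (u - eta *: grad f u) - (v - eta *: grad f' v) =
    (u - v) + eta *: (grad f' v - grad f u).
  by rewrite scalerBr !opprB [_ - v]addrC addrACA [- _ + _]addrC.
apply: le_trans (enormD _ _) _; rewrite lerD2l enormZ ger0_norm // mulrC.
apply: ler_wpM2r => //; apply: le_trans (enormD _ _) _; rewrite enormN.
have := enorm_grad_le u L_ge0 cf lf; have := enorm_grad_le v L_ge0 cf' lf'; lra.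
Qed.

End GradientStep.

(* With s = r i, (t + (m - s.+1)) %/ m counts the t' < t with t' %% m = s. *)
Lemma psgd_distance_le (R : realType) (d m : nat) (hm : (0 < m)%N)
    (L beta eta : R) (Z : Type) (l : 'rV[R]_d -> Z -> R) (S S' : m.-tuple Z)
    (i : 'I_m) (r : {perm 'I_m}) (w0 : 'rV[R]_d) (t : nat) :
  0 <= L -> 0 < beta -> 0 <= eta <= 2 / beta ->
  (forall z, is_convex (l ^~ z)) -> (forall z, is_lipschitz L (l ^~ z)) ->
  (forall z, is_smooth beta (l ^~ z)) ->
  (forall j, j != i -> tnth S j = tnth S' j) ->
  enorm (psgd hm l (fun=> eta) S r w0 t - psgd hm l (fun=> eta) S' r w0 t) <=
    2 * L * eta * ((t + (m - (r i).+1)) %/ m)%:R.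
Proof.
move=> L_ge0 b_gt0 eta_bd cl ll sl SS'; have /andP[eta_ge0 _] := eta_bd.
have c_ge0 : 0 <= 2 * L * eta by rewrite !mulr_ge0.
elim: t => [|t IHt] /=; first by rewrite subrr enorm0 mulr_ge0.
set w := psgd _ _ _ S _ _ _ in IHt *; set w' := psgd _ _ _ S' _ _ _ in IHt *.
set s := Ordinal _.
(* If the entry used is not [i], both runs apply the same nonexpansive map, and the count on the
   right cannot decrease. *)
have [si|si] := eqVneq ((r^-1)%g s) i; last first.
  rewrite (SS' _ si).
  apply: le_trans (gradient_step_nonexpansive _ _ b_gt0 eta_bd (cl _) (sl _)) _.
  apply: le_trans IHt _; rewrite ler_wpM2l // ler_nat.
  by rewrite leq_div2r // addSn leqnSn.
have tm : (t %% m)%N = r i by rewrite -si permKV.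
have m_gt : (r i < m)%N by [].
(* Since [t %% m = r i], the old numerator is one below a multiple of [m], so the quotient rises by
   exactly one. *)
have -> : ((t.+1 + (m - (r i).+1)) %/ m = ((t + (m - (r i).+1)) %/ m).+1)%N.
  have E1 : (t + (m - (r i).+1) = t %/ m * m + m.-1)%N.
    by rewrite {1}(divn_eq t m) tm; lia.
  rewrite addSn E1 -addnS prednK // !divnMDl // divnn hm (divn_small (m := m.-1)).
    by rewrite addn0 addn1.
  by rewrite ltn_predL.
rewrite -[(_ %/ _).+1%:R]natr1 mulrDr mulr1.
apply: le_trans (gradient_step_lipschitz _ _ L_ge0 eta_ge0 (cl _) (ll _) (cl _) (ll _)) _.
by rewrite lerD2r.
Qed.

Theorem corollary1 (R : realType) (d m k : nat)
    (hd : (0 < d)%N) (hm : (0 < m)%N) (hk : (0 < k)%N)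
    (L beta eta : R) (hL : 0 < L) (hbeta : 0 < beta)
    (heta : 0 < eta <= 2 / beta)
    (Z : Type) (l : 'rV[R]_d -> Z -> R)
    (hdiff : forall (z : Z) (w : 'rV[R]_d), differentiable (l ^~ z) w)
    (hconvex : forall z : Z, is_convex (l ^~ z))
    (hlip : forall z : Z, is_lipschitz L (l ^~ z))
    (hsmooth : forall z : Z, is_smooth beta (l ^~ z))
    (w0 : 'rV[R]_d) :
  (ereal_sup [set ereal_sup
      [set (psgd_delta hm k l (fun=> eta) w0 p.1 p.2 r)%:E
        | r in [set: {perm 'I_m}]]
    | p in [set p : m.-tuple Z * m.-tuple Z | neighboring p.1 p.2]]
   <= (2 * k%:R * L * eta)%:E)%E.
Proof.
apply: ge_ereal_sup => _ [[S S'] /= [i [_ SS']] <-].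
apply: ge_ereal_sup => _ [r _ <-]; rewrite lee_fin.
case/andP: heta => eta_gt0 eta_le.
have eta_bd : 0 <= eta <= 2 / beta by rewrite ltW.
have := psgd_distance_le hm r w0 (k * m) (ltW hL) hbeta eta_bd hconvex hlip hsmooth SS'.
(* At time [k * m] the offset [m - (r i).+1] is below [m], so the count is exactly [k] wherever [r]
   places [i]. *)
rewrite divnMDl // divn_small ?addn0; last by rewrite ltn_subrL.
by move=> /le_trans; apply; rewrite -!mulrA [k%:R * _]mulrC -!mulrA.
Qed.
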